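(* Let $\alpha>0$. There exists $C=C(\alpha)>0$ such that for all real $x\geq 2$, we have $\#T_{\leq x}(\alpha)\leq C\,x(\log x)^{15}$.
   Context: $\mathbb{N}$ is the set of positive integers; $\lfloor x\rfloor$ is the integer part (floor) of $x$. For $X\subseteq\mathbb{N}$, $T(X)$ is the set of all tuples $(k,\ell,m)\in\mathbb{N}^3$ with $k\leq \ell\leq m$ such that all of $k,\ \ell,\ m,\ k+\ell,\ \ell+m,\ m+k,\ k+\ell+m$ belong to $X$. For $\alpha>0$, let $S(\alpha)=\{\lfloor \alpha n^2\rfloor : n\in\mathbb{N},\ n\geq \alpha^{-1/2}\}$ and $T(\alpha)=T(S(\alpha))$. For $\alpha>0$ and $x>1$, let $T_{\leq x}(\alpha)=\{(\lfloor \alpha n_1^2\rfloor,\lfloor\alpha n_2^2\rfloor,\lfloor\alpha n_3^2\rfloor)\in T(\alpha) : n_1,n_2,n_3\in[\alpha^{-1/2},x]\cap\mathbb{N}\}$. *)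

(* Defs.v *)
From mathcomp Require Import all_boot all_order all_algebra.
From mathcomp Require Import finmap.
From mathcomp Require Import all_classical all_reals all_analysis.

Set Implicit Arguments.
Unset Strict Implicit.
Unset Printing Implicit Defensive.

Import Order.TTheory GRing.Theory Num.Theory.

Local Open Scope classical_set_scope.
Local Open Scope ring_scope.

(* The positive integers are the [n : nat] with [(0 < n)%N]; [k <= l <= m] makes
   [0 < k] enough for a triple of positive integers. *)
Definition sum_triples (X : set nat) : set (nat * nat * nat) :=
  [set t | let: (k, l, m) := t in
    (0 < k)%N /\ (k <= l <= m)%N /\
    [/\ X k, X l & X m] /\
    [/\ X (k + l)%N, X (l + m)%N & X (m + k)%N] /\ X (k + l + m)%N].

(* [Num.truncn] is the floor, as a natural number, of a nonnegative real. *)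
Definition floor_sq (R : realType) (alpha : R) (n : nat) : nat :=
  Num.truncn (alpha * n%:R ^+ 2).

Definition floor_squares (R : realType) (alpha : R) : set nat :=
  [set floor_sq alpha n | n in
    [set n : nat | (0 < n)%N /\ alpha `^ (- (1 / 2)) <= n%:R]].

Definition index_range (R : realType) (alpha x : R) : set nat :=
  [set n : nat | (0 < n)%N /\ alpha `^ (- (1 / 2)) <= n%:R <= x].

Definition sum_triples_le (R : realType) (alpha x : R) :
    set (nat * nat * nat) :=
  [set t | sum_triples (floor_squares alpha) t /\
    exists n1 n2 n3 : nat,
      [/\ index_range alpha x n1, index_range alpha x n2,
          index_range alpha x n3 &
          t = (floor_sq alpha n1, floor_sq alpha n2, floor_sq alpha n3)]].

(* [fset_set] is empty on infinite sets; by this lemma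
   [#|` fset_set (sum_triples_le alpha x)|] is the true cardinality. *)
Lemma finite_sum_triples_le (R : realType) (alpha x : R) :
  finite_set (sum_triples_le alpha x).
Proof.
have fI : finite_set (floor_sq alpha @` index_range alpha x).
  apply: finite_image; apply: (@sub_finite_set _ _ `I_(Num.truncn x).+1).
    move=> n [_ /andP[_ nx]] /=; rewrite ltnS truncn_ge_nat//.
    exact: le_trans nx.
  exact: finite_II.
apply: sub_finite_set (finite_setX (finite_setX fI fI) fI).
move=> t [_ [n1 [n2 [n3 [h1 h2 h3 ->]]]]].
by split; [split; [exists n1|exists n2]|exists n3].
Qed.

(* Main.v *)
(** Fix the index [c] of the largest element. Each of the other two indices [b]
    satisfies [b^2 + c^2 = d^2 + O(1)] for some [d], so that [d - b] divides one of
    the [O(1)] numbers [c^2 - h], [|h| <= H]: outside finitely many triples, the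
    count is at most the sum over [c <= x] and [h] of [tau (c^2 - h)^2], up to a
    constant.
    For [h = 0] use [tau (c^2)^2 <= tau (c)^4 <= tau_16 (c)]. For [h <> 0] Landreau's
    inequality bounds [tau (N)^2] by a sum of [tau_7 (q)] over the divisors
    [q <= sqrt N] of [N], the congruence [c^2 = h] has [O(tau (q) x / q)] solutions
    [c <= x] modulo such a [q], and [tau tau_7 <= tau_14]. Both cases reduce to
    bounding the sum of [tau_k (q) / q] over [q <= x] by the [k]-th power of a
    harmonic sum. *)
Require Import Defs.
From mathcomp Require Import all_boot all_order all_algebra.
From mathcomp Require Import finmap.
From mathcomp Require Import all_classical all_reals all_analysis.
From mathcomp Require Import zify lra.

Import Order.TTheory GRing.Theory Num.Theory.

(** * Sums over divisors, Euler products and divisor functions *)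

(** A divisor [d] of [a * b] splits as [gcdn d a * gcdn d b]; by Gauss's lemma the product
    determines both factors. *)
Lemma perm_divisors_mul a b : 0 < a -> 0 < b -> coprime a b ->
  perm_eq (divisors (a * b)) [seq d * e | d <- divisors a, e <- divisors b].
Proof.
move=> a_gt0 b_gt0 co_ab; apply: uniq_perm; first exact: divisors_uniq.
  apply: allpairs_uniq; rewrite ?divisors_uniq//.
  move=> [d e] [d' e'] /allpairsP[[x y] /= [xa yb [-> ->]]].
  move=> /allpairsP[[z t] /= [za tb [-> ->]]].
  move: xa yb za tb; rewrite -!dvdn_divisors// => xa yb za tb eq_xy.
  have co u v : u %| a -> v %| b -> coprime u v.
    by move=> ua vb; apply: coprime_dvdl ua _; apply: coprime_dvdr vb _.
  have x_gt0 := dvdn_gt0 a_gt0 xa.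
  suff xz : x = z.
    by subst z; move/eqP: eq_xy; rewrite eqn_pmul2l// => /eqP ->.
  apply/eqP; rewrite eqn_dvd; apply/andP; split.
    by rewrite -(@Gauss_dvdl x z t) ?co// -eq_xy dvdn_mulr.
  by rewrite -(@Gauss_dvdl z x y) ?co// eq_xy dvdn_mulr.
move=> d; apply/idP/allpairsP => [|[[x y] /= [xa yb ->]]].
  rewrite -dvdn_divisors ?muln_gt0 ?a_gt0// => dab.
  exists (gcdn d a, gcdn d b) => /=; split.
  - by rewrite -dvdn_divisors// dvdn_gcdr.
  - by rewrite -dvdn_divisors// dvdn_gcdr.
  apply/eqP; rewrite eqn_dvd; apply/andP; split.
    by rewrite muln_gcdl !muln_gcdr !dvdn_gcd dab dvdn_mulr// dvdn_mulr// dvdn_mull.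
  rewrite Gauss_dvd ?dvdn_gcdl// (coprime_dvdl (dvdn_gcdr d a))//.
  by rewrite (coprime_dvdr (dvdn_gcdr d b)).
rewrite -dvdn_divisors ?muln_gt0 ?a_gt0//.
by rewrite dvdn_mul// dvdn_divisors.
Qed.

Lemma sum_divisors_mul a b (F : nat -> nat) : 0 < a -> 0 < b -> coprime a b ->
  \sum_(d <- divisors (a * b)) F d =
  \sum_(d <- divisors a) \sum_(e <- divisors b) F (d * e).
Proof.
by move=> a0 b0 co; rewrite (perm_big _ (perm_divisors_mul a b a0 b0 co)) big_allpairs_dep.
Qed.

Lemma sum_divisors_pfactor p k (F : nat -> nat) : prime p ->
  \sum_(d <- divisors (p ^ k)) F d = \sum_(i < k.+1) F (p ^ i).
Proof.
move=> p_pr; rewrite -(big_mkord xpredT (fun i => F (p ^ i))).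
rewrite -(big_map (expn p) xpredT F); apply: perm_big.
apply: uniq_perm; rewrite ?divisors_uniq ?map_inj_uniq ?iota_uniq//.
  by apply: expnI; apply: prime_gt1.
move=> d; rewrite -dvdn_divisors ?expn_gt0 ?prime_gt0//.
apply/(dvdn_pfactor _ _ p_pr)/mapP => -[i].
  by move=> ik ->; exists i; rewrite // mem_index_iota.
by rewrite mem_index_iota /= => ik ->; exists i.
Qed.

(** Induction on [s]: the power of the head prime is coprime to the product of the others, so the
    divisor sum factors. *)
Lemma euler_product_seq (s : seq nat) (k : nat -> nat) (G : nat -> nat -> nat) :
    uniq s -> all prime s ->
  \sum_(d <- divisors (\prod_(p <- s) p ^ k p)) \prod_(p <- s) G p (logn p d) =
  \prod_(p <- s) \sum_(i < (k p).+1) G p i.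
Proof.
elim: s => [|p s IHs] /=; first by rewrite big_nil big_seq1 !big_nil.
move=> /andP[ps s_uniq] /andP[p_pr s_pr].
have gt0 : 0 < \prod_(q <- s) q ^ k q.
  rewrite big_seq prodn_cond_gt0// => q qs.
  by rewrite expn_gt0 prime_gt0// (allP s_pr).
have co : coprime (p ^ k p) (\prod_(q <- s) q ^ k q).
  rewrite big_seq; elim/big_rec: _ => [|q m qs IHm]; first exact: coprimen1.
  rewrite coprimeMr IHm andbT coprimeXl// coprimeXr// prime_coprime//.
  rewrite dvdn_prime2 ?(allP s_pr _ qs)//.
  by apply: contra ps => /eqP ->.
have pk_gt0 i : 0 < p ^ i by rewrite expn_gt0 prime_gt0.
rewrite !big_cons sum_divisors_mul// sum_divisors_pfactor//.
rewrite big_distrl /=; apply: eq_bigr => i _.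
rewrite -(IHs s_uniq s_pr) big_distrr /= big_seq [RHS]big_seq.
apply: eq_bigr => d; rewrite -dvdn_divisors// => dm.
have d_gt0 := dvdn_gt0 gt0 dm.
(* If [k p = 0], coprimality to [p ^ k p = 1] says nothing; then [p] is excluded because it is not
   in [s]. *)
have pd : ~~ (p %| d).
  have [k0|k_gt0] := posnP (k p); last first.
    rewrite -prime_coprime//; apply: coprime_dvdr dm _.
    by rewrite -(coprime_pexpl p _ k_gt0).
  apply: contra ps => /dvdn_trans/(_ dm) pm; move: pm.
  rewrite big_seq; elim/big_rec: _ => [|q m qs IHm].
    by rewrite dvdn1 => /eqP p1; rewrite p1 in p_pr.
  rewrite Euclid_dvdM// => /orP[|//].
  rewrite Euclid_dvdX// dvdn_prime2 ?(allP s_pr _ qs)// => /andP[/eqP -> _].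
  by [].
rewrite big_cons; congr (_ * _).
  rewrite lognM// pfactorK//.
  by rewrite (_ : logn p d = 0) ?addn0//; apply/eqP; rewrite -leqn0 -ltnS ltnNge
     -pfactor_dvdn// expn1.
rewrite big_seq [RHS]big_seq; apply: eq_bigr => q qs.
have q_pr := allP s_pr _ qs.
rewrite lognM// lognX.
rewrite (logn_prime q p_pr) (_ : (q == p) = false) ?muln0//.
by apply: contraNF ps => /eqP <-.
Qed.

Lemma euler_product N (G : nat -> nat -> nat) : 0 < N ->
  \sum_(d <- divisors N) \prod_(p <- primes N) G p (logn p d) =
  \prod_(p <- primes N) \sum_(i < (logn p N).+1) G p i.
Proof.
move=> N_gt0.
have def_N : N = \prod_(p <- primes N) p ^ logn p N.
  by rewrite {1}(prod_prime_decomp N_gt0) prime_decompE big_map.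
rewrite {1}def_N; apply: euler_product_seq; first exact: primes_uniq.
by apply/allP => p; rewrite mem_primes => /andP[].
Qed.

(* [divisor_fun j n] is the number of ordered factorizations of [n] into [j.+1]
   factors; in particular [divisor_fun 1] counts the divisors. *)
Fixpoint divisor_fun j n :=
  if j is i.+1 then \sum_(d <- divisors n) divisor_fun i d else 1.

Lemma divisor_fun1 n : divisor_fun 1 n = size (divisors n).
Proof. by rewrite /= sum1_size. Qed.

(** Primes of [N] not dividing [d] contribute [G p 0 = 1]. Once the product runs over the fixed list
    [primes N], [euler_product] applies to sums over [d]. *)
Lemma prod_primes_dvd d N (G : nat -> nat -> nat) :
    0 < N -> d %| N -> (forall p, G p 0 = 1) ->
  \prod_(p <- primes d) G p (logn p d) = \prod_(p <- primes N) G p (logn p d).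
Proof.
move=> N_gt0 dN G0; have d_gt0 := dvdn_gt0 N_gt0 dN.
rewrite [RHS](bigID (mem (primes d))) /= [X in _ * X]big1 ?muln1.
  rewrite -[RHS]big_filter; apply: perm_big; apply: uniq_perm.
  - exact: primes_uniq.
  - by rewrite filter_uniq// primes_uniq.
  move=> p; rewrite mem_filter -andbC /=; apply/idP/andP => [pd|[]//].
  split=> //; move: pd; rewrite !mem_primes N_gt0 => /and3P[-> _ pd] /=.
  exact: dvdn_trans dN.
by move=> p; rewrite -logn_gt0 -eqn0Ngt => /eqP ->.
Qed.

Lemma divisor_fun1_prod N : 0 < N ->
  divisor_fun 1 N = \prod_(p <- primes N) (logn p N).+1.
Proof.
move=> N_gt0; have := euler_product N (fun _ _ => 1) N_gt0.
under eq_bigr do rewrite big1//.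
by move=> /= ->; apply: eq_bigr => p _; rewrite sum1_card card_ord.
Qed.

(** Induction on [j] through the Euler product: at exponent [k > 0], the sum of [1 + j * i] over
    [i <= k] is at least [k + (1 + j * k)]. *)
Lemma prod_logn_le_divisor_fun j n : 0 < n ->
  \prod_(p <- primes n) (1 + j * logn p n) <= divisor_fun j n.
Proof.
elim: j n => [|j IHj] n n_gt0; first by rewrite big1.
apply: (@leq_trans (\sum_(d <- divisors n)
    \prod_(p <- primes d) (1 + j * logn p d))); last first.
  rewrite /= big_seq [leqRHS]big_seq; apply: leq_sum => d.
  by rewrite -dvdn_divisors// => /(dvdn_gt0 n_gt0)/IHj.
have -> : \sum_(d <- divisors n) \prod_(p <- primes d) (1 + j * logn p d) =
    \sum_(d <- divisors n) \prod_(p <- primes n) (1 + j * logn p d).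
  rewrite big_seq [RHS]big_seq; apply: eq_bigr => d; rewrite -dvdn_divisors//.
  by move=> dn; apply: (@prod_primes_dvd d n (fun _ i => 1 + j * i)) => // p; rewrite muln0.
rewrite (@euler_product n (fun _ i => 1 + j * i))//.
rewrite big_seq [leqRHS]big_seq.
apply: leq_prod => p; rewrite -logn_gt0 => k_gt0.
case: (logn p n) k_gt0 => // k _.
rewrite big_ord_recr big_split /= sum1_card card_ord; lia.
Qed.

Lemma divisor_fun1M m n : 0 < m -> 0 < n ->
  divisor_fun 1 (m * n) <= divisor_fun 1 m * divisor_fun 1 n.
Proof.
move=> m_gt0 n_gt0; rewrite !divisor_fun1.
rewrite -(size_allpairs muln); apply: uniq_leq_size; first exact: divisors_uniq.
move=> d; rewrite -dvdn_divisors ?muln_gt0 ?m_gt0// => dmn.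
have d_gt0 : 0 < d by apply: dvdn_gt0 dmn; rewrite muln_gt0 m_gt0.
have g_gt0 : 0 < gcdn d m by rewrite gcdn_gt0 d_gt0.
apply/allpairsP; exists (gcdn d m, d %/ gcdn d m) => /=; split.
- by rewrite -dvdn_divisors// dvdn_gcdr.
- rewrite -dvdn_divisors// -(dvdn_pmul2l g_gt0) mulnC divnK ?dvdn_gcdl//.
  by rewrite muln_gcdl dvdn_gcd dmn dvdn_mulr.
by rewrite mulnC divnK// dvdn_gcdl.
Qed.

Lemma sum_divisors_divisors n (F : nat -> nat) : 0 < n ->
  \sum_(d <- divisors n) \sum_(e <- divisors d) F e =
  \sum_(e <- divisors n) divisor_fun 1 (n %/ e) * F e.
Proof.
move=> n_gt0; transitivity
    (\sum_(d <- divisors n) \sum_(e <- divisors n | e %| d) F e).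
  rewrite big_seq [RHS]big_seq; apply: eq_bigr => d.
  rewrite -dvdn_divisors// => dn; have d_gt0 := dvdn_gt0 n_gt0 dn.
  rewrite -[RHS]big_filter; apply: perm_big; apply: uniq_perm.
  - exact: divisors_uniq.
  - by rewrite filter_uniq// divisors_uniq.
  move=> e; rewrite mem_filter -!dvdn_divisors//.
  by apply/idP/andP => [ed|[]//]; split=> //; apply: dvdn_trans dn.
rewrite (exchange_big_dep xpredT)//= big_seq [RHS]big_seq.
apply: eq_bigr => e; rewrite -dvdn_divisors// => en.
have e_gt0 := dvdn_gt0 n_gt0 en.
have ne_gt0 : 0 < n %/ e by rewrite divn_gt0// dvdn_leq.
rewrite -big_filter big_const_seq count_predT iter_addn_0 mulnC.
rewrite sum1_size -(size_map (muln e) (divisors (n %/ e))).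
congr (_ * _); apply/perm_size/uniq_perm.
- by rewrite filter_uniq// divisors_uniq.
- rewrite map_inj_uniq ?divisors_uniq// => a b /eqP.
  by rewrite eqn_pmul2l// => /eqP.
move=> d; rewrite mem_filter -dvdn_divisors//; apply/andP/mapP => [[ed dn]|[f]].
  exists (d %/ e); last by rewrite mulnC divnK.
  by rewrite -dvdn_divisors// -(dvdn_pmul2l e_gt0) ![e * _]mulnC !divnK.
rewrite -dvdn_divisors// -(dvdn_pmul2l e_gt0) [e * (_ %/ _)]mulnC divnK// => ? ->.
by rewrite dvdn_mulr.
Qed.

(** This is [tau * tau_(j+1) <= tau_(2j+2)]. Inside the sum over [d],
    [tau n <= tau (n %/ d) * tau d], and the factor [tau (n %/ d)] amounts to one more nested
    divisor sum. *)
Lemma divisor_funM j n : 0 < n ->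
  divisor_fun 1 n * divisor_fun j n <= divisor_fun j.*2.+1 n.
Proof.
elim: j n => [|j IHj] n n_gt0; first by rewrite [divisor_fun 0 n]/= muln1.
have -> : divisor_fun j.+1.*2.+1 n =
    \sum_(d <- divisors n) \sum_(e <- divisors d) divisor_fun j.*2.+1 e by [].
rewrite sum_divisors_divisors// [divisor_fun j.+1 n]/= big_distrr /=.
rewrite big_seq [leqRHS]big_seq; apply: leq_sum => d.
rewrite -dvdn_divisors// => dn; have d_gt0 := dvdn_gt0 n_gt0 dn.
have nd_gt0 : 0 < n %/ d by rewrite divn_gt0// dvdn_leq.
apply: (leq_trans _ (leq_mul (leqnn _) (IHj d d_gt0))).
rewrite mulnA leq_mul2r; apply/orP; right.
by have := @divisor_fun1M (n %/ d) d nd_gt0 d_gt0; rewrite divnK.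
Qed.

(** From [tau (n ^ 2) <= tau n ^ 2], the four factors [tau n] are merged one at a time, through the
    indices 1, 3, 7, 15. *)
Lemma divisor_fun_sqr_sqr n : 0 < n -> divisor_fun 1 (n ^ 2) ^ 2 <= divisor_fun 15 n.
Proof.
move=> n_gt0; apply: leq_trans (divisor_funM 7 n n_gt0).
set t := divisor_fun 1 n.
have le2 : t * t <= divisor_fun 3 n := divisor_funM 1 n n_gt0.
have le3 := divisor_funM 3 n n_gt0.
have le1 : divisor_fun 1 (n ^ 2) <= t * t by apply: divisor_fun1M.
apply: (@leq_trans ((t * t) * (t * t))); first by apply: leq_mul.
rewrite -mulnA leq_mul2l; apply/orP; right.
by apply: leq_trans le3; rewrite leq_mul2l le2 orbT.
Qed.

(** * Landreau's inequality by tent weights *)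

(** Symmetric under [i |-> k - i] and at most [1 + 6 * i], the local factor bounding [divisor_fun 6]
    from below. The slope 6 is the least one whose total reaches [(k + 1) ^ 2] at [k = 2]. *)
Definition tent k i := 1 + 6 * minn i (k - i).

Lemma sum_tent1 : \sum_(i < 2) tent 1 i = 2.
Proof. by rewrite !big_ord_recl big_ord0. Qed.

Lemma sum_tent_ge k : k != 1 -> k.+1 ^ 2 <= \sum_(i < k.+1) tent k i.
Proof.
(* Dropping both end points and lowering the rest by 6 turns [tent k.+2] into [tent k], so the
   induction carries two consecutive cases. The term [(k == 1).*2] fills the deficit at [k = 1]. *)
suff [H1 H2] : k.+1 ^ 2 <= \sum_(i < k.+1) tent k i + (k == 1).*2 /\
             k.+2 ^ 2 <= \sum_(i < k.+2) tent k.+1 i + (k == 0).*2.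
  by move=> /negPf k1; rewrite k1 addn0 in H1.
have step m : \sum_(i < m.+3) tent m.+2 i = \sum_(i < m.+1) tent m i + 6 * m.+1 + 2.
  rewrite big_ord_recl big_ord_recr /=.
  have -> : \sum_(i < m.+1) tent m.+2 (lift ord0 (widen_ord (leqnSn m.+1) i)) =
      \sum_(i < m.+1) (tent m i + 6).
    by apply: eq_bigr => -[i /= im] _; rewrite /tent /bump /=; lia.
  by rewrite big_split /= sum_nat_const card_ord /tent /bump /=; lia.
elim: k => [|k [IH1 IH2]].
  split; first by rewrite !big_ord_recl big_ord0.
  by rewrite sum_tent1.
split; first by move: IH2; case: k {IH1} => [|k]; rewrite /= ?addn0.
case: k IH1 {IH2} => [|k] IH1.
  by rewrite !big_ord_recl big_ord0.
rewrite step /=; move: IH1; case: k => [|k] /=; rewrite ?addn0.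
  by rewrite sum_tent1.
nia.
Qed.

Lemma prod_if_const (T : Type) (s : seq T) (a : pred T) c :
  \prod_(p <- s) (if a p then c else 1) = c ^ count a s.
Proof. by rewrite -big_mkcond big_const_seq iter_muln_1. Qed.

(** Bernoulli's inequality gives [(40 / 39) ^ r >= 1 + r / 39], which is at least 4 from
    [r = 3 * 39] on. *)
Lemma pow39_pow40 r : 117 <= r -> 4 * 39 ^ r <= 40 ^ r.
Proof.
have bernoulli n : (n + 39) * 39 ^ n <= 39 * 40 ^ n.
  elim: n => [|n]; rewrite ?expnS; first lia.
  by set x := 39 ^ n; set y := 40 ^ n; nia.
move=> r_ge; have := bernoulli r.
by set x := 39 ^ r; set y := 40 ^ r; nia.
Qed.

Lemma leq_wexp2r m n e : m <= n -> m ^ e <= n ^ e.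
Proof. by case: e => // e mn; rewrite leq_exp2r. Qed.

(* If at least 3/8 of the [u + v] primes are taken then [2 ^ (u + v) <= 7 ^ u]
   since [2 ^ 8 <= 7 ^ 3]; the other choices are exponentially rare, which the
   weights 15 and 24 detect because [4 ^ 3 * 5 ^ 5 <= 3 ^ 3 * 6 ^ 5] while
   [15 + 24 < 2 * 20]. *)
Lemma chernoff_weights u v :
  40 ^ (u + v) <= 20 ^ (u + v) * 7 ^ u + 2 ^ (u + v) * (15 ^ u * 24 ^ v).
Proof.
have -> : 40 ^ (u + v) = 20 ^ (u + v) * 2 ^ (u + v) by rewrite -expnMn.
have [uv|vu] := leqP (3 * v) (5 * u).
  apply: leq_trans (leq_addr _ _); rewrite leq_mul2l; apply/orP; right.
  rewrite -(@leq_exp2r _ _ 3)// -!expnM.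
  apply: (@leq_trans (2 ^ (8 * u))); first by rewrite leq_exp2l//; lia.
  by rewrite [u * 3]mulnC [2 ^ _]expnM [7 ^ _]expnM leq_wexp2r.
apply: leq_trans (leq_addl _ _); rewrite mulnC leq_mul2l; apply/orP; right.
have -> : 20 ^ (u + v) = 5 ^ u * 4 ^ v * (4 ^ u * 5 ^ v).
  by rewrite mulnACA -!expnMn expnD.
have -> : 15 ^ u * 24 ^ v = 5 ^ u * 4 ^ v * (3 ^ u * 6 ^ v).
  by rewrite mulnACA -!expnMn.
rewrite leq_mul2l; apply/orP; right.
(* The target becomes [(4 / 3) ^ (5 * u) <= (6 / 5) ^ (5 * v)]; as [5 * u < 3 * v], the [v]-th power
   of the numerical inequality suffices. *)
rewrite -(@leq_exp2r _ _ 5)// !expnMn -!expnM.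
have [w def_v] : exists w, 3 * v = u * 5 + w by exists (3 * v - u * 5); lia.
have le_w : 3 ^ w <= 4 ^ w by apply: leq_wexp2r.
have le_v : 4 ^ (3 * v) * 5 ^ (v * 5) <= 3 ^ (3 * v) * 6 ^ (v * 5).
  by rewrite ![v * 5]mulnC !expnM -!expnMn leq_wexp2r//; vm_compute.
have u_gt0 : 0 < 3 ^ (3 * v) by rewrite expn_gt0.
move: le_v u_gt0; rewrite def_v !expnD => le_v u_gt0.
rewrite -(leq_pmul2r u_gt0); apply: leq_trans
  (_ : 3 ^ (u * 5) * (4 ^ (u * 5) * 4 ^ w * 5 ^ (v * 5)) <= _).
  rewrite mulnC -!mulnA leq_mul2l; apply/orP; right.
  by rewrite mulnCA leq_mul2l leq_mul2r le_w !orbT.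
by rewrite -[leqRHS]mulnA [X in _ <= _ * X]mulnC leq_mul2l le_v orbT.
Qed.

Lemma sum_divisors_compl N (F : nat -> nat) : 0 < N ->
  \sum_(d <- divisors N) F d = \sum_(d <- divisors N) F (N %/ d).
Proof.
move=> N_gt0; rewrite -[RHS](big_map (divn N) xpredT F); apply: perm_big.
have divK d : d %| N -> N %/ (N %/ d) = d.
  move=> dN; have d_gt0 := dvdn_gt0 N_gt0 dN.
  by rewrite -[in LHS](divnK dN) mulnK ?mulKn// divn_gt0// dvdn_leq.
apply: uniq_perm; first exact: divisors_uniq.
  rewrite map_inj_in_uniq ?divisors_uniq// => d e; rewrite -!dvdn_divisors//.
  by move=> dN eN /(congr1 (divn N)); rewrite !divK.
move=> d; rewrite -dvdn_divisors//; apply/idP/mapP => [dN|[e]].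
  by exists (N %/ d); rewrite ?divK// -dvdn_divisors// dvdn_div.
by rewrite -dvdn_divisors// => eN ->; apply: dvdn_div.
Qed.

(** [d] and [N %/ d] cannot both exceed the square root of [N]. *)
Lemma sum_divisors_sym N (F : nat -> nat) : 0 < N ->
    (forall d, d %| N -> F (N %/ d) = F d) ->
  \sum_(d <- divisors N) F d <= 2 * \sum_(d <- divisors N | d ^ 2 <= N) F d.
Proof.
move=> N_gt0 symF; rewrite (bigID (fun d => d ^ 2 <= N)) /= mul2n -addnn leq_add2l.
rewrite [leqLHS]big_mkcond (sum_divisors_compl N _ N_gt0) [leqRHS]big_mkcond.
rewrite big_seq [leqRHS]big_seq; apply: leq_sum => d; rewrite -dvdn_divisors//.
move=> dN; rewrite symF//; case: ifP => // big; case: ifP => // /negP[].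
move: big; rewrite -ltnNge -{1 3}(divnK dN); nia.
Qed.

(* A divisor weight invariant under [d |-> N %/ d], so that the divisors up to the
   square root of [N] carry at least half of its mass. At the primes dividing [N]
   exactly once it takes the value 1, leaving a factor 7 to gain from [divisor_fun 6]. *)
Definition tent_prod N d := \prod_(p <- primes N) tent (logn p N) (logn p d).

Lemma tent_prod_sym N d : 0 < N -> d %| N -> tent_prod N (N %/ d) = tent_prod N d.
Proof.
move=> N_gt0 dN; apply: eq_bigr => p _; rewrite logn_div// /tent.
have : logn p d <= logn p N by apply: dvdn_leq_log.
lia.
Qed.

Section Landreau.
Variables (N : nat) (N_gt0 : 0 < N).
(** Primes dividing [N] exactly once are singled out: there the tent total is 2 where 4 is
    wanted. *)
Let b p := logn p N == 1.
Let r := count b (primes N).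
Let K := \prod_(p <- primes N) (if b p then 1 else \sum_(i < (logn p N).+1) tent (logn p N) i).
Let u d := count (fun p => b p && (0 < logn p d)) (primes N).
Let v d := count (fun p => b p && (logn p d == 0)) (primes N).

Lemma u_add_v d : u d + v d = r.
Proof.
rewrite /u /v /r -count_predUI [X in _ + X](_ : _ = 0).
  by rewrite addn0; apply: eq_count => p /=; case: (b p) => //=; case: (logn p d).
rewrite -[RHS](count_pred0 (primes N)); apply: eq_count => p /=.
by case: (b p) => //=; case: (logn p d).
Qed.

(** At exponent 1 both tent values are 1, so the local factor is [w 0 + w 1]; the other primes
    ignore [w] and give [K]. *)
Lemma sum_tent_prod_weight (w : nat -> nat) :
  \sum_(d <- divisors N) tent_prod N d *
    \prod_(p <- primes N) (if b p then w (logn p d) else 1) =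
  (w 0 + w 1) ^ r * K.
Proof.
under eq_bigr do rewrite -big_split/=.
rewrite (@euler_product N (fun p i => tent (logn p N) i * if b p then w i else 1))//.
rewrite /r -prod_if_const -big_split/=; apply: eq_bigr => p _; rewrite /b.
case: eqP => [->|_]; last by rewrite mul1n; apply: eq_bigr => i _; rewrite muln1.
by rewrite !big_ord_recl big_ord0 /tent /= !mul1n muln1 addn0.
Qed.

Lemma sum_tent_prod : \sum_(d <- divisors N) tent_prod N d = 2 ^ r * K.
Proof.
rewrite -[2]/(1 + 1) -(sum_tent_prod_weight (fun _ => 1)).
by apply: eq_bigr => d _; rewrite [X in _ * X]big1 ?muln1// => p _; case: ifP.
Qed.

Lemma sum_tent_prod_chernoff :
  \sum_(d <- divisors N) tent_prod N d * (15 ^ u d * 24 ^ v d) = 39 ^ r * K.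
Proof.
rewrite -[39]/(24 + 15) -(sum_tent_prod_weight (fun i => if i == 0 then 24 else 15)).
apply: eq_bigr => d _; congr (_ * _).
rewrite -!prod_if_const -big_split; apply: eq_bigr => p _ /=.
by case: (b p) => //=; case: (logn p d).
Qed.

Lemma divisor_fun1_sqr_le : divisor_fun 1 N ^ 2 <= 4 ^ r * K.
Proof.
rewrite divisor_fun1_prod// -mulnn -big_split /r -prod_if_const -big_split /=.
apply: leq_prod => p _; rewrite /b; case: eqP => [->//|/eqP k1].
by rewrite mul1n mulnn sum_tent_ge.
Qed.

Lemma pow7_tent_prod d :
  7 ^ u d * tent_prod N d <= \prod_(p <- primes N) (1 + 6 * logn p d).
Proof.
rewrite -prod_if_const -big_split /=; apply: leq_prod => p _.
rewrite /b /tent; case: eqP => [->|_] /=; last by rewrite mul1n; lia.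
by case: (logn p d) => [|i] /=; lia.
Qed.

(** At least half of the tent mass [2 ^ r * K] sits on small divisors, so [4 ^ r * K] lacks a factor
    [2 ^ r]. For [r < 117] the constant absorbs it; for larger [r] it comes from the weights
    [7 ^ u d]. *)
Lemma divisor_fun1_sqr_small_aux :
  divisor_fun 1 N ^ 2 <= 2 ^ 118 *
    \sum_(d <- divisors N | d ^ 2 <= N) \prod_(p <- primes N) (1 + 6 * logn p d).
Proof.
apply: leq_trans divisor_fun1_sqr_le _.
set S := \sum_(d <- divisors N | _) _.
have leS : \sum_(d <- divisors N | d ^ 2 <= N) 7 ^ u d * tent_prod N d <= S.
  by apply: leq_sum => d _; apply: pow7_tent_prod.
have le_half := sum_divisors_sym N _ N_gt0 (fun d => tent_prod_sym N d N_gt0).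
rewrite sum_tent_prod in le_half.
have [r_ge|r_lt] := leqP 117 r; last first.
  have : \sum_(d <- divisors N | d ^ 2 <= N) tent_prod N d <= S.
    apply: leq_trans leS; apply: leq_sum => d _.
    by rewrite leq_pmull// expn_gt0.
  have : 2 ^ r <= 2 ^ 117 by rewrite leq_exp2l// ltnW.
  rewrite (expnS _ 117) (expnMn 2 2); move: le_half.
  set T := \sum_(d <- _ | _) _; set x := 2 ^ r; set y := 2 ^ 117.
  move: T S {leS} => T S le1 le2 le3.
  rewrite -mulnA; apply: leq_trans (_ : x * (2 * T) <= _).
    by rewrite leq_mul2l le1 orbT.
  rewrite mulnCA -mulnA leq_mul2l /=.
  by apply: leq_mul.
suff le4 : 4 ^ r * K <= 4 * S.
  apply: leq_trans le4 _; rewrite leq_mul2r; apply/orP; right.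
  by rewrite -[4]/(2 ^ 2) leq_exp2l.
(* [chernoff_weights] summed over the small divisors; extending the exceptional term to all divisors
   gives it a closed form. *)
have le1 : 40 ^ r * \sum_(d <- divisors N | d ^ 2 <= N) tent_prod N d <=
    20 ^ r * S + 2 ^ r * (39 ^ r * K).
  rewrite -sum_tent_prod_chernoff.
  apply: leq_trans (leq_add (leq_mul (leqnn (20 ^ r)) leS) (leqnn _)).
  rewrite [X in _ <= _ + _ * X](bigID (fun d => d ^ 2 <= N)) /= mulnDr addnA.
  apply: leq_trans (leq_addr _ _); rewrite !big_distrr -big_split /=.
  apply: leq_sum => d _; have := chernoff_weights (u d) (v d).
  rewrite u_add_v => le; have := leq_mul le (leqnn (tent_prod N d)).
  by rewrite mulnDl -!mulnA [24 ^ _ * tent_prod _ _]mulnC [15 ^ _ * (_ * _)]mulnCA.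
have e80 : 40 ^ r * 2 ^ r = 20 ^ r * 4 ^ r by rewrite -!expnMn.
have gt20 : 0 < 20 ^ r by rewrite expn_gt0.
rewrite -(@leq_pmul2l (20 ^ r))//.
move: (pow39_pow40 r r_ge) le1 le_half e80.
set T := \sum_(d <- _ | _) tent_prod _ _.
set x := 40 ^ r; set y := 39 ^ r; set z := 20 ^ r; set w := 2 ^ r; set q := 4 ^ r.
move: T S K x y z w q {leS gt20} => T S' K' x y z w q le39 le1 le2 e80.
rewrite mulnA -e80.
(* Since [4 * 39 ^ r <= 40 ^ r], the exceptional term is at most half of the left side and can be
   moved across. *)
have h1 : x * (w * K') <= 2 * (z * S' + w * (y * K')).
  by apply: leq_trans (leq_mul (leqnn x) le2) _; rewrite mulnCA leq_mul2l le1.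
have h2 : 4 * (w * (y * K')) <= x * (w * K').
  by rewrite [w * (y * _)]mulnCA mulnA leq_mul2r le39 orbT.
rewrite -mulnA; lia.
Qed.

End Landreau.

(* Landreau's inequality, with the truncation at the square root. *)
Lemma divisor_fun1_sqr_small : exists c, forall N, 0 < N ->
  divisor_fun 1 N ^ 2 <= c * \sum_(d <- divisors N | d ^ 2 <= N) divisor_fun 6 d.
Proof.
exists (2 ^ 118) => N N_gt0; apply: leq_trans (divisor_fun1_sqr_small_aux N N_gt0) _.
rewrite leq_mul2l; apply/orP; right.
rewrite big_seq_cond [leqRHS]big_seq_cond; apply: leq_sum => d /andP[].
rewrite -dvdn_divisors// => dN _.
apply: leq_trans (prod_logn_le_divisor_fun 6 d (dvdn_gt0 N_gt0 dN)).
by rewrite -(@prod_primes_dvd d N (fun _ i => 1 + 6 * i)).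
Qed.

(** * Averages of divisor functions by harmonic sums *)

Section DivisorSums.
Local Open Scope ring_scope.

Lemma sum_dvdn (V : nmodType) (Y d : nat) (F : nat -> V) : (0 < d)%N ->
  \sum_(1 <= n < Y.+1 | (d %| n)%N) F n = \sum_(1 <= e < (Y %/ d).+1) F (d * e)%N.
Proof.
move=> d_gt0; rewrite -big_filter -(big_map (muln d) xpredT F).
apply: perm_big; apply: uniq_perm.
- by rewrite filter_uniq// iota_uniq.
- rewrite map_inj_uniq ?iota_uniq// => a b /eqP.
  by rewrite eqn_pmul2l// => /eqP.
move=> n; rewrite mem_filter mem_index_iota; apply/idP/mapP.
  move=> /andP[dn nY]; exists (n %/ d)%N; last by rewrite mulnC divnK.
  by rewrite mem_index_iota divn_gt0// dvdn_leq ?ltnS ?leq_div2r//; lia.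
move=> [e]; rewrite mem_index_iota => /andP[e_gt0 eY] ->.
rewrite dvdn_mulr// muln_gt0 d_gt0 e_gt0 /= ltnS mulnC -leq_divRL//.
Qed.

Lemma sum_sum_divisors (V : nmodType) (Y : nat) (F : nat -> nat -> V) :
  \sum_(1 <= n < Y.+1) \sum_(d <- divisors n) F d n =
  \sum_(1 <= d < Y.+1) \sum_(1 <= e < (Y %/ d).+1) F d (d * e)%N.
Proof.
transitivity (\sum_(1 <= n < Y.+1) \sum_(1 <= d < Y.+1 | (d %| n)%N) F d n).
  apply: eq_big_nat => n /andP[n_gt0 nY].
  rewrite -[RHS]big_filter; apply: perm_big; apply: uniq_perm.
  - exact: divisors_uniq.
  - by rewrite filter_uniq// iota_uniq.
  move=> d; rewrite mem_filter mem_index_iota -dvdn_divisors//.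
  apply/idP/andP => [dn|[]//]; split=> //.
  by rewrite (dvdn_gt0 n_gt0 dn) (leq_ltn_trans (dvdn_leq n_gt0 dn)).
rewrite (exchange_big_dep_nat xpredT)//=; apply: eq_big_nat => d /andP[d_gt0 _].
exact: (sum_dvdn _ _ _ (F d)).
Qed.

Variable R : realFieldType.

Definition harmonic_sum (Y : nat) : R := \sum_(1 <= n < Y.+1) n%:R^-1.

Lemma le_harmonic_sum : {homo harmonic_sum : m n / (m <= n)%N >-> m <= n}.
Proof.
move=> m n mn; rewrite /harmonic_sum [leRHS](@big_cat_nat _ _ _ m.+1)//= lerDl.
by apply: sumr_ge0 => i _; rewrite invr_ge0.
Qed.

Lemma harmonic_sum_ge0 Y : 0 <= harmonic_sum Y.
Proof. by apply: sumr_ge0 => i _; rewrite invr_ge0. Qed.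

(** Writing [n = d * e] splits off a sum of [1 / e] over [e <= Y %/ d], enlarged to [e <= Y]. *)
Lemma sum_divisor_fun_div j Y :
  \sum_(1 <= n < Y.+1) (divisor_fun j n)%:R / n%:R <= harmonic_sum Y ^+ j.+1.
Proof.
elim: j => [|j IHj]; first by under eq_bigr do rewrite mul1r.
rewrite /=; under eq_bigr do rewrite natr_sum big_distrl/=.
rewrite (sum_sum_divisors _ Y (fun d n => (divisor_fun j d)%:R / n%:R)) exprSr.
apply: le_trans (ler_wpM2r (harmonic_sum_ge0 Y) IHj).
rewrite big_distrl /=; apply: ler_sum => d _.
rewrite [leLHS](_ : _ = (divisor_fun j d)%:R / d%:R * harmonic_sum (Y %/ d)).
  by rewrite ler_wpM2l ?divr_ge0// le_harmonic_sum// leq_div.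
by rewrite big_distrr; apply: eq_bigr => e _; rewrite natrM invfM mulrA.
Qed.

(** The innermost sum has [Y %/ d <= Y / d] equal terms, so [tau_(j+2)] costs only [j + 1] harmonic
    factors. *)
Lemma sum_divisor_fun j Y :
  \sum_(1 <= n < Y.+1) (divisor_fun j.+1 n)%:R <= Y%:R * harmonic_sum Y ^+ j.+1.
Proof.
rewrite /=; under eq_bigr do rewrite natr_sum.
rewrite (sum_sum_divisors _ Y (fun d n => (divisor_fun j d)%:R)).
apply: le_trans (ler_wpM2l (ler0n _ Y) (sum_divisor_fun_div j Y)).
rewrite big_distrr /= big_nat_cond [leRHS]big_nat_cond; apply: ler_sum => d.
rewrite andbT => /andP[d_gt0 _].
rewrite sumr_const_nat subSS subn0 -[leLHS]mulr_natr mulrCA ler_wpM2l//.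
by rewrite ler_pdivlMr ?ltr0n// -natrM ler_nat leq_divM.
Qed.

End DivisorSums.

(** * Roots of a quadratic congruence *)

Lemma count_congruent (P : pred nat) L X : 0 < L ->
    (forall a b, P a -> P b -> a <= b -> L %| b - a) ->
  count P (index_iota 1 X.+1) <= (X %/ L).+1.
Proof.
move=> L_gt0 congP; rewrite -size_filter -(size_map (divn^~ L)).
rewrite -[leqRHS](size_iota 0); apply: uniq_leq_size.
  rewrite map_inj_in_uniq ?filter_uniq ?iota_uniq//.
  suff inj a b : P a -> P b -> a <= b -> a %/ L = b %/ L -> a = b.
    move=> a b; rewrite !mem_filter => /andP[Pa _] /andP[Pb _] eq_ab.
    by case: (leqP a b) => [|/ltnW] le_ab; [|symmetry]; apply: inj.
  move=> Pa Pb le_ab eq_ab; have /dvdnP[k def_k] := congP a b Pa Pb le_ab.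
  have def_b : b = k * L + a by rewrite -def_k subnK.
  move: eq_ab; rewrite def_b divnMDl// => /esym/eqP.
  by rewrite -[X in _ == X]add0n eqn_add2r => /eqP ->.
move=> c /mapP[a]; rewrite mem_filter mem_index_iota => /and3P[_ _ aX] ->.
by rewrite mem_iota /= add0n ltnS leq_div2r.
Qed.

Section QuadraticCongruence.
Variables (H j q : nat) (q_gt0 : 0 < q) (jH : j != H) (j_le : j <= 2 * H).

(** With [j <= 2 * H], [j - H] encodes a shift of absolute value at most [H]; [H < a] keeps the
    truncated subtraction exact. *)
Let root a := (H < a) && (q %| a ^ 2 + j - H).

Let dvd_sub_sqr a b : root a -> root b -> a <= b -> q %| (b - a) * (b + a).
Proof.
move=> /andP[Ha qa] /andP[Hb qb] ab; rewrite -subn_sqr.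
have -> : b ^ 2 - a ^ 2 = (b ^ 2 + j - H) - (a ^ 2 + j - H) by nia.
exact: dvdn_sub.
Qed.

(* If [a] and [a0] are both roots then [q] splits as [g * (q %/ g)] with
   [g] dividing [a - a0] and [q %/ g] dividing [a + a0]. Given [g], this fixes [a]
   modulo the lcm of the two factors, whose gcd has a square dividing
   [4 * (j - H)]. *)
Lemma count_quadratic_roots X :
  q * count (fun a => (H < a) && (q %| a ^ 2 + j - H)) (index_iota 1 X.+1) <=
  divisor_fun 1 q * (4 * H * X + q).
Proof.
rewrite -/root; have [ex|none] := boolP (has root (index_iota 1 X.+1)); last first.
  by rewrite (_ : count _ _ = 0) ?muln0//; apply/eqP; rewrite -leqn0 leqNgt -has_count.
(* Taking the least root as base point keeps every [a - a0] free of truncation. *)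
have /ex_minnP[a0 root0 min0] : exists a, root a by have /hasP[a _ ?] := ex; exists a.
pose class g a := [&& root a, g %| a - a0 & q %/ g %| a + a0].
have le_sum : count root (index_iota 1 X.+1) <=
    \sum_(g <- divisors q) count (class g) (index_iota 1 X.+1).
  rewrite (eq_bigr (fun g => \sum_(a <- index_iota 1 X.+1) (class g a : nat)));
    last by move=> g _; rewrite -sum1_count big_mkcond; apply: eq_bigr => a _; case: (class g a).
  rewrite exchange_big /= -sum1_count big_mkcond; apply: leq_sum => a _.
  case: ifP => // ra; pose g := gcdn q (a - a0).
  have gq : g \in divisors q by rewrite -dvdn_divisors// dvdn_gcdl.
  rewrite (big_rem g)//= (_ : class g a) ?leq_addr// /class ra dvdn_gcdr /=.
  have g_gt0 : 0 < g by rewrite gcdn_gt0 q_gt0.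
  (* [q] divides [q * (a + a0)] and [(a - a0) * (a + a0)], hence [g * (a + a0)]. *)
  rewrite -(dvdn_pmul2l g_gt0) mulnC divnK ?dvdn_gcdl//.
  by rewrite muln_gcdl dvdn_gcd dvdn_mulr//= dvd_sub_sqr// min0.
apply: leq_trans (leq_mul (leqnn q) le_sum) _.
rewrite divisor_fun1 -sum1_size big_distrr big_distrl /=.
rewrite big_seq [leqRHS]big_seq; apply: leq_sum => g; rewrite -dvdn_divisors// => gq.
rewrite mul1n; have [ex_g|none] := boolP (has (class g) (index_iota 1 X.+1)); last first.
  by rewrite (_ : count _ _ = 0) ?muln0//; apply/eqP; rewrite -leqn0 leqNgt -has_count.
have g_gt0 := dvdn_gt0 q_gt0 gq.
set f := q %/ g; have f_gt0 : 0 < f by rewrite divn_gt0// dvdn_leq.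
have def_q : g * f = q by rewrite mulnC divnK.
have L_gt0 : 0 < lcmn g f by rewrite lcmn_gt0 g_gt0.
have le_count : count (class g) (index_iota 1 X.+1) <= (X %/ lcmn g f).+1.
  apply: count_congruent => // a b /and3P[ra ga fa] /and3P[rb gb fb] ab.
  rewrite dvdn_lcm; apply/andP; split.
    rewrite (_ : b - a = (b - a0) - (a - a0)); first exact: dvdn_sub.
    by have := min0 a ra; move: ab; clear; lia.
  by rewrite (_ : b - a = (b + a0) - (a + a0)); [exact: dvdn_sub|rewrite subnDr].
(* The gcd [e] divides [(a - a0) + (a + a0) = 2 * a], and [e * e] divides [g * f = q]; the two
   resulting multiples of [e * e] differ because [j != H]. *)
have gcd_le : gcdn g f <= 4 * H.
  have /hasP[a _ /and3P[ra ga fa]] := ex_g; set e := gcdn g f.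
  have e2a : e %| 2 * a.
    have ga' : e %| a - a0 := dvdn_trans (dvdn_gcdl g f) ga.
    have fa' : e %| a + a0 := dvdn_trans (dvdn_gcdr g f) fa.
    rewrite (_ : 2 * a = (a - a0) + (a + a0)); first exact: dvdn_add.
    by move: (min0 a ra); clear; lia.
  have ee1 : e * e %| 4 * a ^ 2.
    by rewrite (_ : 4 * a ^ 2 = (2 * a) * (2 * a)) ?dvdn_mul// mulnACA mulnn.
  have ee2 : e * e %| 4 * (a ^ 2 + j - H).
    apply: dvdn_mull; apply: (@dvdn_trans q); last by case/andP: ra.
    by rewrite -def_q dvdn_mul// ?dvdn_gcdl ?dvdn_gcdr.
  have Ha : H < a by case/andP: ra.
  suff ee : e * e <= 4 * H.
    apply: leq_trans ee; case: (e) => // e'; exact: leq_pmulr.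
  have [jltH|Hltj] := ltnP j H.
    apply: (@leq_trans (4 * (H - j))); last by rewrite leq_mul2l leq_subr.
    apply: dvdn_leq; first by rewrite muln_gt0 subn_gt0.
    rewrite (_ : 4 * (H - j) = 4 * a ^ 2 - 4 * (a ^ 2 + j - H)); first exact: dvdn_sub.
    have Haa : H <= a ^ 2 by apply: leq_trans (ltnW Ha) _; case: (a) => // a'; rewrite leq_pmulr.
    by move: Haa jltH; set c := a ^ 2; clear; lia.
  have jltH : H < j by rewrite ltn_neqAle eq_sym jH.
  apply: (@leq_trans (4 * (j - H))); last first.
    by rewrite leq_mul2l leq_subLR addnn -mul2n.
  apply: dvdn_leq; first by rewrite muln_gt0 subn_gt0.
  rewrite (_ : 4 * (j - H) = 4 * (a ^ 2 + j - H) - 4 * a ^ 2); first exact: dvdn_sub.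
  by move: jltH; set c := a ^ 2; clear; lia.
have lcm_gcd := muln_lcm_gcd g f; rewrite def_q in lcm_gcd.
apply: leq_trans (leq_mul (leqnn q) le_count) _.
rewrite mulnS addnC leq_add2r -{1}lcm_gcd mulnAC.
rewrite mulnC; apply: leq_mul => //.
by rewrite mulnC leq_divM.
Qed.

End QuadraticCongruence.

(** * Mean squares of divisor counts at shifted squares *)

#[local] Arguments divisor_fun : simpl never.

(** Cauchy-Schwarz, from [2 * x * y <= x ^ 2 + y ^ 2] over all pairs of indices. *)
Lemma sqr_sum_le n (t : 'I_n -> nat) :
  (\sum_i t i) ^ 2 <= n * \sum_i t i ^ 2.
Proof.
rewrite -(@leq_pmul2l 2)//; apply: (@leq_trans (\sum_i \sum_j (t i ^ 2 + t j ^ 2))).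
  rewrite -mulnn big_distrlr big_distrr /=; apply: leq_sum => i _.
  by rewrite big_distrr /=; apply: leq_sum => j _; rewrite nat_Cauchy.
under eq_bigr do rewrite big_split /= sum_nat_const card_ord.
by rewrite big_split /= sum_nat_const card_ord -big_distrr /= addnn mul2n.
Qed.

Definition landreau_constant c := forall N, 0 < N ->
  divisor_fun 1 N ^ 2 <= c * \sum_(d <- divisors N | d ^ 2 <= N) divisor_fun 6 d.

(** From [d ^ 2 <= a ^ 2 + j - H <= (X + H) ^ 2] follows [d <= X + H], a range independent of [a],
    so the sums can be exchanged. *)
Lemma sum_divisor_fun1_sqr_le c H j X : landreau_constant c -> j <= 2 * H ->
  \sum_(1 <= a < X.+1 | H < a) divisor_fun 1 (a ^ 2 + j - H) ^ 2 <=
  c * \sum_(1 <= d < (X + H).+1) divisor_fun 6 d *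
    count (fun a => (H < a) && (d %| a ^ 2 + j - H)) (index_iota 1 X.+1).
Proof.
move=> landreau jH; apply: (@leq_trans (c * \sum_(1 <= a < X.+1 | H < a)
    \sum_(1 <= d < (X + H).+1 | d %| a ^ 2 + j - H) divisor_fun 6 d)).
  rewrite big_distrr /= big_nat_cond [leqRHS]big_nat_cond; apply: leq_sum => a.
  move=> /andP[/andP[a_gt0 aX] Ha].
  have Haa : H < a ^ 2 by apply: leq_trans Ha _; rewrite -mulnn leq_pmulr.
  have N_gt0 : 0 < a ^ 2 + j - H by move: Haa; set c2 := a ^ 2; lia.
  apply: leq_trans (landreau _ N_gt0) _.
  rewrite leq_mul2l; apply/orP; right.
  rewrite -big_filter -[leqRHS]big_filter.
  apply: (uniq_sub_le_big leqnn (fun x y => leq_addr y x)).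
  - by rewrite filter_uniq// divisors_uniq.
  - by rewrite filter_uniq// iota_uniq.
  move=> d; rewrite !mem_filter mem_index_iota -dvdn_divisors// => /andP[dd dN].
  rewrite dN (dvdn_gt0 N_gt0 dN) /= ltnS -(@leq_exp2r _ _ 2)//.
  apply: leq_trans dd _; rewrite sqrnD.
  have : a ^ 2 <= X ^ 2 by rewrite leq_exp2r.
  set c2 := a ^ 2; set e := X ^ 2; set f := 2 * _; nia.
rewrite leq_mul2l; apply/orP; right.
rewrite (exchange_big_dep_nat xpredT)//=; apply: leq_sum => d _.
rewrite -big_filter big_const_seq count_predT iter_addn_0 size_filter leq_mul2l.
by apply/orP; right.
Qed.

Section RealBounds.
Local Open Scope ring_scope.
Variable R : realFieldType.

(** The root count is at most [tau d * (4 * H * X + d) / d]; with [d <= X + H] and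
    [tau * tau_7 <= tau_14], only the sum of [tau_14 d / d] remains. *)
Lemma sum_shifted_square c H j X : landreau_constant c -> (j != H)%N -> (j <= 2 * H)%N ->
  (\sum_(1 <= a < X.+1 | (H < a)%N) divisor_fun 1 (a ^ 2 + j - H) ^ 2)%:R <=
  c%:R * (4 * H * X + (X + H))%:R * harmonic_sum R (X + H) ^+ 14.
Proof.
move=> landreau jH j_le.
have := sum_divisor_fun1_sqr_le c H j X landreau j_le; rewrite -(ler_nat R) => /le_trans; apply.
rewrite natrM -mulrA ler_wpM2l// natr_sum.
apply: le_trans (ler_wpM2l (ler0n _ _) (sum_divisor_fun_div R 13 (X + H))).
rewrite big_distrr /= big_nat_cond [leRHS]big_nat_cond; apply: ler_sum => d.
rewrite andbT => /andP[d_gt0 dY].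
rewrite mulrA ler_pdivlMr ?ltr0n// -!natrM ler_nat.
rewrite -[leqLHS]mulnA [(count _ _ * d)%N]mulnC.
apply: leq_trans (leq_mul (leqnn _) (count_quadratic_roots H j d d_gt0 jH j_le X)) _.
rewrite mulnA [(divisor_fun 6 d * _)%N]mulnC [leqRHS]mulnC.
apply: leq_mul; first exact: divisor_funM 6 d d_gt0.
by rewrite leq_add2l -ltnS.
Qed.

Lemma sum_square_divisor_fun X :
  (\sum_(1 <= a < X.+1) divisor_fun 1 (a ^ 2) ^ 2)%:R <=
  X%:R * harmonic_sum R X ^+ 15.
Proof.
apply: le_trans (sum_divisor_fun R 14 X); rewrite -natr_sum ler_nat.
rewrite big_nat_cond [leqRHS]big_nat_cond; apply: leq_sum => a.
by rewrite andbT => /andP[a_gt0 _]; apply: divisor_fun_sqr_sqr.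
Qed.

(** Cauchy-Schwarz over the [2 * H + 1] shifts reduces to a single [j]. The perfect squares at
    [j = H] cost the exponent 15, the other shifts only 14. *)
Lemma sum_sqr_sum_divisor_fun H : exists2 C : R, 0 < C & forall X : nat, (0 < X)%N ->
  (\sum_(1 <= a < X.+1 | (H < a)%N)
     (\sum_(j < (2 * H).+1) divisor_fun 1 (a ^ 2 + j - H)) ^ 2)%:R <=
  C * X%:R * harmonic_sum R (X + H) ^+ 15.
Proof.
have [c landreau] := divisor_fun1_sqr_small.
(* The summand 1 serves [j = H]; the other serves the remaining shifts, as
   [4 * H * X + X + H <= (5 * H + 1) * X] for [X >= 1]. *)
pose C1 : R := 1 + c%:R * (5 * H + 1)%:R.
have C1_ge1 : 1 <= C1 by rewrite lerDl mulr_ge0.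
exists ((2 * H).+1%:R * ((2 * H).+1%:R * C1)) => [|X X_gt0].
  by rewrite !mulr_gt0// (lt_le_trans ltr01).
set h := harmonic_sum R (X + H).
have h_ge1 : 1 <= h.
  apply: (@le_trans _ _ (harmonic_sum R 1)).
    by rewrite /harmonic_sum big_nat1 invr1.
  by apply: le_harmonic_sum; rewrite addn_gt0 X_gt0.
have bound j : (j <= 2 * H)%N ->
    (\sum_(1 <= a < X.+1 | (H < a)%N) divisor_fun 1 (a ^ 2 + j - H) ^ 2)%:R <=
    C1 * X%:R * h ^+ 15.
  move=> j_le; have [->|jH] := eqVneq j H.
    apply: (@le_trans _ _ (X%:R * h ^+ 15)); last first.
      by rewrite ler_wpM2r ?exprn_ge0 ?(le_trans ler01)// ler_peMl.
    apply: (@le_trans _ _ (X%:R * harmonic_sum R X ^+ 15)).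
      apply: le_trans (sum_square_divisor_fun X); rewrite ler_nat.
      rewrite big_mkcond /=; apply: leq_sum => a _; case: ifP => // _.
      by rewrite addnK.
    rewrite ler_wpM2l// lerXn2r ?nnegrE ?harmonic_sum_ge0//.
    by rewrite le_harmonic_sum// leq_addr.
  apply: le_trans (sum_shifted_square c H j X landreau jH j_le) _.
  apply: ler_pM; rewrite ?mulr_ge0 ?exprn_ge0 ?ler0n ?harmonic_sum_ge0//; last first.
    by rewrite -/h [leRHS]exprSr ler_peMr// exprn_ge0// (le_trans ler01).
  rewrite mulrDl mul1r -mulrA; apply: le_trans (_ : c%:R * ((5 * H + 1)%:R * X%:R) <= _).
    rewrite ler_wpM2l// -natrM ler_nat; nia.
  by rewrite lerDr.
apply: (@le_trans _ _ ((2 * H).+1%:R * \sum_(j < (2 * H).+1)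
    (\sum_(1 <= a < X.+1 | (H < a)%N) divisor_fun 1 (a ^ 2 + j - H) ^ 2)%:R)).
  rewrite -natr_sum -natrM ler_nat exchange_big /= big_distrr /=.
  by apply: leq_sum => a _; apply: sqr_sum_le.
rewrite -!mulrA ler_wpM2l//.
apply: le_trans (_ : \sum_(j < (2 * H).+1) C1 * X%:R * h ^+ 15 <= _).
  by apply: ler_sum => j _; apply: bound; rewrite -ltnS.
by rewrite sumr_const card_ord -[leLHS]mulr_natl -!mulrA.
Qed.

End RealBounds.

(** * Covering the triples by factorizations *)

(** A factorization [e * f] of [c ^ 2 + j - H] is read as [(d - b) * (d + b)], so [b = (f - e) / 2].
    Spurious values do no harm to an upper bound. *)
Definition neighbours H c := flatten
  [seq [seq ((c ^ 2 + j - H) %/ e - e)./2 | e <- divisors (c ^ 2 + j - H)]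
  | j <- iota 0 (2 * H).+1].

Lemma size_neighbours H c :
  size (neighbours H c) = \sum_(j < (2 * H).+1) divisor_fun 1 (c ^ 2 + j - H).
Proof.
rewrite size_flatten /shape -map_comp sumnE big_map.
rewrite -(big_mkord xpredT (fun j => divisor_fun 1 (c ^ 2 + j - H))).
by rewrite /index_iota subn0; apply: eq_bigr => j _; rewrite divisor_fun1 /= size_map.
Qed.

(** Take [j = d ^ 2 + H - (b ^ 2 + c ^ 2)] and the divisor [d - b]; [H < c] forces [b < d]. *)
Lemma mem_neighbours H b c d : H < c ->
  b ^ 2 + c ^ 2 < d ^ 2 + H -> d ^ 2 < b ^ 2 + c ^ 2 + H -> b \in neighbours H c.
Proof.
move=> Hc bcd dbc.
have cc : c <= c ^ 2 by rewrite -mulnn leq_pmulr// (leq_ltn_trans _ Hc).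
have bd : b < d.
  rewrite -(@ltn_exp2r _ _ 2)//.
  by move: Hc bcd cc; set B := b ^ 2; set D := d ^ 2; set E := c ^ 2; clear; lia.
have sub_gt0 : 0 < d - b by rewrite subn_gt0.
have def_N : c ^ 2 + (d ^ 2 + H - (b ^ 2 + c ^ 2)) - H = (d - b) * (d + b).
  rewrite -subn_sqr; have : b ^ 2 < d ^ 2 by rewrite ltn_exp2r.
  by move: Hc bcd cc; set B := b ^ 2; set D := d ^ 2; set E := c ^ 2; clear; lia.
apply/flatten_mapP; exists (d ^ 2 + H - (b ^ 2 + c ^ 2)).
  rewrite mem_iota /=.
  by move: bcd dbc; set B := b ^ 2; set D := d ^ 2; set E := c ^ 2; clear; lia.
apply/mapP; exists (d - b).
  by rewrite def_N -dvdn_divisors ?dvdn_mulr// muln_gt0 sub_gt0; lia.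
rewrite def_N mulKn// (_ : d + b - (d - b) = b.*2) ?doubleK//.
by move: bd; clear; lia.
Qed.

Section Counting.
Local Open Scope classical_set_scope.
Local Open Scope ring_scope.
Variables (R : realType) (alpha : R) (alpha_gt0 : 0 < alpha).

Local Notation H := (Num.truncn (2 / alpha)).+1.

Let floor_sq_itv n :
  (floor_sq alpha n)%:R <= alpha * n%:R ^+ 2 < (floor_sq alpha n).+1%:R.
Proof. by apply: truncn_itv; rewrite mulr_ge0 ?exprn_ge0// ltW. Qed.

(** The equation keeps [alpha * (a ^ 2 + b ^ 2 - d ^ 2)] below 2 in absolute value, and
    [H > 2 / alpha]. *)
Lemma floor_sq_add a b d : (floor_sq alpha a + floor_sq alpha b)%N = floor_sq alpha d ->
  (a ^ 2 + b ^ 2 < d ^ 2 + H)%N /\ (d ^ 2 < a ^ 2 + b ^ 2 + H)%N.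
Proof.
have HR : 2 < alpha * H%:R.
  by rewrite mulrC -ltr_pdivrMr// truncnS_gt.
move: H HR => h HR eq_d.
have := floor_sq_itv a; have := floor_sq_itv b; have := floor_sq_itv d.
rewrite -eq_d -!natr1 natrD => /andP[d1 d2] /andP[b1 b2] /andP[a1 a2].
rewrite -!(ltr_nat R) !natrD !natrX.
by split; rewrite -(ltr_pM2l alpha_gt0) !mulrDr; lra.
Qed.

Lemma le_floor_sq m n : (m <= n)%N -> (floor_sq alpha m <= floor_sq alpha n)%N.
Proof.
move=> mn; rewrite /floor_sq; apply: le_truncn.
by rewrite ler_wpM2l ?(ltW alpha_gt0)// lerXn2r ?nnegrE// ler_nat.
Qed.

Lemma card_sum_triples_le (x : R) :
  (#|` fset_set (sum_triples_le alpha x)| <=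
    (floor_sq alpha H).+1 ^ 3 +
    \sum_(1 <= c < (Num.truncn x).+1 | (H < c)%N)
      (\sum_(j < (2 * H).+1) divisor_fun 1 (c ^ 2 + j - H)) ^ 2)%N.
Proof.
pose box := iota 0 (floor_sq alpha H).+1.
pose small := [seq (kl, m) | kl <- [seq (k, l) | k <- box, l <- box], m <- box].
(* For [c > H], membership of [l + m] and [m + k] makes the indices of [l] and [k] neighbours of
   [c]. *)
pose large := flatten [seq [seq (floor_sq alpha a, floor_sq alpha b, floor_sq alpha c)
  | a <- neighbours H c, b <- neighbours H c] | c <- index_iota 1 (Num.truncn x).+1 & (H < c)%N].
have -> : ((floor_sq alpha H).+1 ^ 3)%N = size small.
  by rewrite !size_allpairs size_iota; lia.
have -> : (\sum_(1 <= c < (Num.truncn x).+1 | (H < c)%N)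
      (\sum_(j < (2 * H).+1) divisor_fun 1 (c ^ 2 + j - H)) ^ 2)%N = size large.
  rewrite size_flatten /shape -map_comp sumnE big_map big_filter.
  by apply: eq_bigr => c _; rewrite /= size_allpairs size_neighbours mulnn.
rewrite -size_cat; apply: uniq_leq_size; first exact: fset_uniq.
move=> t; rewrite in_fset_set; last exact: finite_sum_triples_le.
move=> /set_mem[Tt [a [b [c [[a_gt0 _] [b_gt0 _] [c_gt0 /andP[_ cx]] def_t]]]]].
move: Tt; rewrite def_t.
move=> [_ [/andP[kl lm] [_ [[_ [d _ ld] [f _ mk]] _]]]].
rewrite mem_cat; have [Hc|cH] := ltnP H c; apply/orP; [right|left].
  have [d1 d2] := floor_sq_add _ _ _ (esym ld).
  have [f1 f2] := floor_sq_add _ _ _ (esym mk).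
  apply/flattenP; exists [seq (floor_sq alpha a, floor_sq alpha b, floor_sq alpha c)
    | a <- neighbours H c, b <- neighbours H c].
    apply/mapP; exists c => //; rewrite mem_filter Hc mem_index_iota c_gt0 ltnS.
    by rewrite truncn_ge_nat// (le_trans _ cx).
  apply/allpairsP; exists (a, b) => /=; split=> //.
    by apply: (@mem_neighbours _ _ _ f); rewrite // [(a ^ 2 + _)%N]addnC.
  exact: (@mem_neighbours _ _ _ d).
have mH := le_floor_sq _ _ cH.
apply/allpairsP; exists ((floor_sq alpha a, floor_sq alpha b), floor_sq alpha c).
split=> //; last by rewrite mem_iota add0n ltnS.
apply/allpairsP; exists (floor_sq alpha a, floor_sq alpha b).
by split=> //; rewrite mem_iota add0n ltnS (leq_trans _ mH)// (leq_trans kl).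
Qed.

End Counting.

(** * Harmonic sums against logarithms, and the final estimate *)

Local Open Scope classical_set_scope.
Local Open Scope ring_scope.

(** The step [1 / (n + 2) <= ln (n + 2) - ln (n + 1)] is [ln (1 + t) <= t] at
    [t = - 1 / (n + 2)]. *)
Lemma harmonic_sum_le_ln (R : realType) n : harmonic_sum R n.+1 <= 1 + ln n.+1%:R.
Proof.
elim: n => [|n IHn]; first by rewrite /harmonic_sum big_nat1 invr1 ln1 addr0.
rewrite /harmonic_sum big_nat_recr//= -/(harmonic_sum R n.+1).
apply: le_trans (lerD IHn (lexx _)) _; rewrite -addrA lerD2l.
have inv_lt1 : n.+2%:R^-1 < 1 :> R by rewrite invf_lt1 ?ltr0n// ltr1n.
have /le_ln1Dx : -1 < - n.+2%:R^-1 :> R by rewrite ltrN2.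
have -> : 1 - n.+2%:R^-1 = n.+1%:R / n.+2%:R :> R.
  have n2_neq0 : n.+2%:R != 0 :> R by rewrite pnatr_eq0.
  by rewrite -[n.+1%:R](addrK 1) natr1 mulrBl mul1r divff.
by rewrite ln_div ?posrE ?ltr0n// => le_ln; rewrite -lerBrDr addrC -lerBlDr.
Qed.

Theorem theorem1p5 (R : realType) (alpha : R) (alpha_gt0 : 0 < alpha) :
  exists C : R, 0 < C /\
    forall x : R, 2 <= x ->
      (#|` fset_set (sum_triples_le alpha x)|)%:R <= C * x * (ln x) ^+ 15.
Proof.
set H := (Num.truncn (2 / alpha)).+1.
have [C0 C0_gt0 boundC0] := sum_sqr_sum_divisor_fun R H.
have ln2_gt0 : 0 < ln 2 :> R by rewrite ln_gt0// ltr1n.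
pose C1 : R := ((floor_sq alpha H).+1 ^ 3)%:R.
(* Chosen so that [1 + ln x + ln (H + 1) <= C2 * ln x] as soon as [ln x >= ln 2]. *)
pose C2 : R := 1 + (1 + ln H.+1%:R) / ln 2.
have lnH_ge0 : 0 <= ln H.+1%:R :> R by rewrite ln_ge0// ler1n.
have C2_ge0 : 0 <= C2.
  by rewrite addr_ge0// divr_ge0// ?(ltW ln2_gt0)// addr_ge0.
exists (C1 / ln 2 ^+ 15 + C0 * C2 ^+ 15); split.
  rewrite ltr_wpDr ?mulr_ge0 ?exprn_ge0 ?(ltW C0_gt0)//.
  by rewrite divr_gt0 ?exprn_gt0// ltr0n expn_gt0.
move=> x x_ge2; have x_gt0 : 0 < x by apply: lt_le_trans x_ge2.
have lnx : ln 2 <= ln x by rewrite ler_ln ?posrE.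
have lnx_gt0 : 0 < ln x by apply: lt_le_trans lnx.
have := card_sum_triples_le R alpha alpha_gt0 x; rewrite -(ler_nat R) => /le_trans; apply.
rewrite natrD -/H -/C1 mulrDl mulrDl; set X := Num.truncn x.
have X_gt0 : (0 < X)%N by rewrite truncn_gt0; lra.
have Xx : X%:R <= x by rewrite truncn_le ltW.
apply: lerD.
  have x_ge1 : 1 <= x by apply: le_trans x_ge2; rewrite ler1n.
  have le_pow : 1 <= ln x ^+ 15 / ln 2 ^+ 15.
    by rewrite ler_pdivlMr ?exprn_gt0// mul1r lerXn2r ?nnegrE ?(ltW ln2_gt0) ?(ltW lnx_gt0).
  rewrite -mulrA mulrAC -mulrA ler_peMr ?ler0n// -mulrA.
  exact: mulr_ege1.
apply: le_trans (boundC0 X X_gt0) _.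
have -> : C0 * C2 ^+ 15 * x * ln x ^+ 15 = C0 * x * (C2 * ln x) ^+ 15.
  by rewrite exprMn [RHS]mulrACA [RHS]mulrA.
rewrite -[leLHS]mulrA -[leRHS]mulrA ler_wpM2l ?(ltW C0_gt0)//.
apply: ler_pM; rewrite ?exprn_ge0 ?harmonic_sum_ge0//.
rewrite lerXn2r ?nnegrE ?harmonic_sum_ge0 ?mulr_ge0 ?(ltW lnx_gt0)//.
have [n def_n] : exists n, (X + H)%N = n.+1 by exists (X + H).-1; rewrite prednK// addn_gt0 X_gt0.
rewrite def_n; apply: le_trans (harmonic_sum_le_ln R n) _; rewrite -def_n.
have le_ln : ln (X + H)%:R <= ln x + ln H.+1%:R.
  rewrite -lnM ?posrE ?ltr0n// ler_ln ?posrE ?mulr_gt0 ?ltr0n ?addn_gt0 ?X_gt0//.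
  apply: le_trans (_ : X%:R * H.+1%:R <= _); last by rewrite ler_wpM2r.
  by rewrite -natrM ler_nat mulnS leq_add2l leq_pmull.
rewrite /C2 mulrDl mul1r; apply: le_trans (_ : ln x + (1 + ln H.+1%:R) <= _); first lra.
rewrite lerD2l -mulrA ler_peMr ?addr_ge0// mulrC.
by rewrite ler_pdivlMr// mul1r.
Qed.
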